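(* Let each $f_i:\mathbb{R}^d\to\mathbb{R}$ be $L_i$-smooth with $L_i>0$, and put $\bar L=\frac1n\sum_{i=1}^nL_i$. Let $S$ be a sampling with replacement with $\tau$ copies and probabilities $\tilde p_i=L_i/\sum_{j=1}^nL_j$. Then the constant $\mathcal{L}_3$ (defined in the context) satisfies $$\mathcal{L}_3\le\frac{\bar L^2}{\tau}.$$
   Context: $[n]=\{1,\dots,n\}$; $e\in\mathbb{R}^n$ is the all-ones vector. $L$-smooth means differentiable with $L$-Lipschitz gradient; the $f_i$ need not be convex. Sampling with replacement: $S$ is the multiset of $\tau\ge1$ independent indices, each equal to $i\in[n]$ with probability $\tilde p_i$. Weights: $\theta_S^i=1/(\tau\tilde p_i)$; $\theta_S$ is the diagonal matrix with these entries; $\mathbf{I}_S$ is the diagonal matrix whose $i$-th entry is the number of copies of $i$ in $S$; $\mathbf{G}(x)=[\nabla f_1(x),\dots,\nabla f_n(x)]$. Thus $\frac1n\mathbf{G}(x)\theta_S\mathbf{I}_Se=\frac1n\sum_{i\in S}\frac{1}{\tau\tilde p_i}\nabla f_i(x)$ with multiplicities. $\mathcal{L}_3$ is the smallest constant $\ge0$ such that for all $x,y\in\mathbb{R}^d$: $\mathbb{E}\left[\|\frac1n(\mathbf{G}(x)-\mathbf{G}(y))\theta_S\mathbf{I}_Se-\frac1n(\mathbf{G}(x)-\mathbf{G}(y))e\|^2\right]\le\mathcal{L}_3\|x-y\|^2$. *)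

(* Defs.v *)
From HB Require Import structures.
From mathcomp Require Import all_boot all_order all_algebra.
From mathcomp Require Import all_classical all_reals all_analysis.

Set Implicit Arguments.
Unset Strict Implicit.
Unset Printing Implicit Defensive.

Import Order.TTheory GRing.Theory Num.Theory.
Import numFieldNormedType.Exports.

Local Open Scope classical_set_scope.
Local Open Scope ring_scope.

(* Euclidean norm. The canonical norm `|x| on matrices is the sup norm; it
   induces the same topology, hence the same notion of differentiability, but
   Lipschitz constants do depend on the norm. *)
Definition enorm (R : realType) (d : nat) (v : 'cV[R]_d) : R :=
  Num.sqrt (\sum_(j < d) v j 0 ^+ 2).

Definition grad (R : realType) (d : nat) (f : 'cV[R]_d -> R) (x : 'cV[R]_d) :
    'cV[R]_d :=
  \col_(j < d) 'D_(delta_mx j 0) f x.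

Definition smooth (R : realType) (d : nat) (L : R) (f : 'cV[R]_d -> R) : Prop :=
  (forall x, differentiable f x) /\
  (forall x y, enorm (grad f x - grad f y) <= L * enorm (x - y)).

(* The random multiset is represented by the tuple of its tau draws. The
   indices 'I_n carry the discrete sigma-algebra; mutual independence of a
   subfamily of the draws is the case B k = setT for the remaining k. *)
Record sampling_with_replacement (R : realType) (dT : measure_display)
    (T : measurableType dT) (P : probability T R) (n tau : nat)
    (p : 'I_n -> R) (S : T -> tau.-tuple 'I_n) : Prop := {
  draw_measurable : forall (k : 'I_tau) (B : set 'I_n),
    measurable [set w | B (tnth (S w) k)];
  draw_law : forall (k : 'I_tau) (i : 'I_n),
    P [set w | tnth (S w) k = i] = (p i)%:E;
  draw_independent : forall B : 'I_tau -> set 'I_n,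
    P (\bigcap_(k in [set: 'I_tau]) [set w | B k (tnth (S w) k)]) =
    (\prod_(k < tau) P [set w | B k (tnth (S w) k)])%E }.

Definition all_ones (R : realType) (n : nat) : 'cV[R]_n := const_mx 1.

Definition theta_mx (R : realType) (n tau : nat) (p : 'I_n -> R) : 'M[R]_n :=
  diag_mx (\row_(i < n) (tau%:R * p i)^-1).

Definition I_mx (R : realType) (n tau : nat) (s : tau.-tuple 'I_n) : 'M[R]_n :=
  diag_mx (\row_(i < n) (count_mem i s)%:R).

Definition grad_mx (R : realType) (d n : nat) (f : 'I_n -> 'cV[R]_d -> R)
    (x : 'cV[R]_d) : 'M[R]_(d, n) :=
  \matrix_(j < d, i < n) grad (f i) x j 0.

Definition sampling_error (R : realType) (d n tau : nat)
    (f : 'I_n -> 'cV[R]_d -> R) (p : 'I_n -> R) (s : tau.-tuple 'I_n)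
    (x y : 'cV[R]_d) : 'cV[R]_d :=
  n%:R^-1 *: ((grad_mx f x - grad_mx f y)
                *m theta_mx tau p *m I_mx R s *m all_ones R n)
  - n%:R^-1 *: ((grad_mx f x - grad_mx f y) *m all_ones R n).

Definition calL3_bound (R : realType) (dT : measure_display)
    (T : measurableType dT) (P : probability T R) (d n tau : nat)
    (f : 'I_n -> 'cV[R]_d -> R) (p : 'I_n -> R) (S : T -> tau.-tuple 'I_n) :
    set R :=
  [set c | 0 <= c /\ forall x y : 'cV[R]_d,
    ('E_P[(fun w => enorm (sampling_error f p (S w) x y) ^+ 2)%R]
       <= (c * enorm (x - y) ^+ 2)%:E)%E].

Definition is_calL3 (R : realType) (dT : measure_display)
    (T : measurableType dT) (P : probability T R) (d n tau : nat)
    (f : 'I_n -> 'cV[R]_d -> R) (p : 'I_n -> R) (S : T -> tau.-tuple 'I_n)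
    (c : R) : Prop :=
  calL3_bound P f p S c /\ lbound (calL3_bound P f p S) c.

(* Main.v *)
Require Import Defs.
From HB Require Import structures.
From mathcomp Require Import all_boot all_order all_algebra.
From mathcomp Require Import all_classical all_reals all_analysis.
From mathcomp Require Import measurable_realfun ring.

Set Implicit Arguments.
Unset Strict Implicit.
Unset Printing Implicit Defensive.

Import Order.TTheory GRing.Theory Num.Theory.
Import numFieldNormedType.Exports.

Local Open Scope classical_set_scope.
Local Open Scope ring_scope.

(** Write [g i] for the difference of the gradients of [f i] at [x] and [y].
    The sampling error is [(n * tau)^-1] times the sum, over the [tau] draws
    [i], of [g i / p i - \sum_j g j]. These [tau] vectors are independent and
    centered, so the cross terms of the expected squared norm vanish
    ([sum_sqr_centered_iid]). The expectation is thus [(n * tau)^-2 * tau] times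
    the variance of one [g i / p i], which is at most its second moment
    [\sum_i enorm (g i) ^+ 2 / p i] ([second_moment_centered_le]). Smoothness
    bounds [enorm (g i)] by [L i * enorm (x - y)], and for
    [p i = L i / \sum_j L j] the sum is then at most
    [(\sum_j L j) ^+ 2 * enorm (x - y) ^+ 2]. Hence [\bar L^2 / tau] is an
    admissible constant ([expected_sampling_error_le]), and the least
    admissible constant exists because it is the infimum of a nonempty closed
    set of nonnegative reals ([is_calL3_exists]).

    All expectations are reduced to finite sums: the sample takes finitely many
    values, and by independence its law is a product ([sample_law],
    [expectation_finite_range]). *)

(** The expectation of a nonnegative function of a random variable with finite
    range is a finite weighted sum. *)
Lemma expectation_finite_range (R : realType) (dT : measure_display)
    (T : measurableType dT) (P : probability T R) (I : finType) (X : T -> I)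
    (q F : I -> R) :
  (forall i, measurable [set w | X w = i]) ->
  (forall i, P [set w | X w = i] = (q i)%:E) ->
  (forall i, 0 <= F i) ->
  ('E_P[(fun w => F (X w))] = (\sum_i q i * F i)%:E)%E.
Proof.
move=> mX qE F_ge0; rewrite unlock.
have FXE w : (F (X w))%:E =
    (\sum_(i <- index_enum I) (F i)%:E * (\1_[set w | X w = i] w)%:E)%E.
  rewrite (bigD1 (X w)) //= indicE mem_set//= mule1 big1 ?adde0// => i iX.
  by rewrite indicE memNset ?mule0//= => /esym /eqP; exact/negP.
under eq_integral do rewrite FXE.
rewrite ge0_integral_sum//; last first.
- by move=> i w _; rewrite mule_ge0 ?lee_fin.
- move=> i; apply: measurable_funeM; apply/measurable_EFinP.
  exact: measurable_indic.
rewrite -sumEFin; apply: eq_bigr => i _.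
rewrite ge0_integralZl ?lee_fin//; last first.
  by apply/measurable_EFinP; exact: measurable_indic.
rewrite integral_indic//.
by have qEi := qE i; rewrite setIT [X in (_ * X)%E]qEi -EFinM mulrC.
Qed.

Lemma sample_eqE (T : Type) (n tau : nat) (S : T -> tau.-tuple 'I_n)
    (s : tau.-tuple 'I_n) :
  [set w | S w = s] =
  \bigcap_(k in [set: 'I_tau]) [set w | [set tnth s k] (tnth (S w) k)].
Proof.
apply/seteqP; split=> [w /= <- k _//|w /= H].
by apply: eq_from_tnth => k; exact: H.
Qed.

Lemma measurable_sample (R : realType) (dT : measure_display)
    (T : measurableType dT) (P : probability T R) (n tau : nat)
    (p : 'I_n -> R) (S : T -> tau.-tuple 'I_n)
    (HS : sampling_with_replacement P p S) (s : tau.-tuple 'I_n) :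
  measurable [set w | S w = s].
Proof.
rewrite sample_eqE; apply: fin_bigcap_measurable; first exact: finite_finset.
by move=> k _; exact: (draw_measurable HS).
Qed.

(** The draws are independent, so their joint law is the product law. *)
Lemma sample_law (R : realType) (dT : measure_display)
    (T : measurableType dT) (P : probability T R) (n tau : nat)
    (p : 'I_n -> R) (S : T -> tau.-tuple 'I_n)
    (HS : sampling_with_replacement P p S) (s : tau.-tuple 'I_n) :
  P [set w | S w = s] = (\prod_(k < tau) p (tnth s k))%:E.
Proof.
rewrite sample_eqE.
apply: etrans (draw_independent HS (fun k => [set tnth s k])) _.
rewrite -prodEFin.
by apply: eq_bigr => k _; exact: (draw_law HS).
Qed.

Lemma sum_tuple_prod (R : comPzSemiRingType) (I : finType) (m : nat)
    (F : 'I_m -> I -> R) :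
  \sum_(s : m.-tuple I) \prod_(k < m) F k (tnth s k) =
  \prod_(k < m) \sum_i F k i.
Proof.
rewrite bigA_distr_bigA.
rewrite (reindex (fun g : {ffun 'I_m -> I} => [tuple g k | k < m])).
  by apply: eq_bigr => g _; apply: eq_bigr => k _; rewrite tnth_mktuple.
exists (fun s => [ffun k => tnth s k]) => [g _|s _].
  by apply/ffunP => k; rewrite ffunE tnth_mktuple.
by apply: eq_from_tnth => k; rewrite tnth_mktuple ffunE.
Qed.

(** Variance of a sum of [m] independent copies of a centered variable [a] of
    law [p]: the expectation is written as a sum over all outcomes, weighted by
    the product law. *)
Lemma sum_sqr_centered_iid (R : comPzRingType) (I : finType) (m : nat)
    (p a : I -> R) :
  \sum_i p i = 1 -> \sum_i p i * a i = 0 ->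
  \sum_(s : m.-tuple I)
     (\prod_(k < m) p (tnth s k)) * (\sum_(k < m) a (tnth s k)) ^+ 2 =
  m%:R * \sum_i p i * a i ^+ 2.
Proof.
move=> p1 a0.
pose w (s : m.-tuple I) := \prod_(k < m) p (tnth s k).
(* Mixed moments: distinct draws are uncorrelated. *)
have mom (k l : 'I_m) :
    \sum_s w s * (a (tnth s k) * a (tnth s l)) =
    if l == k then \sum_i p i * a i ^+ 2 else 0.
  pose F (r : 'I_m) i :=
    p i * ((if r == k then a i else 1) * (if r == l then a i else 1)).
  transitivity (\sum_(s : m.-tuple I) \prod_(r < m) F r (tnth s r)).
    apply: eq_bigr => s _; rewrite !big_split /=; congr (_ * (_ * _)).
      by rewrite -big_mkcond big_pred1_eq.
    by rewrite -big_mkcond big_pred1_eq.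
  (* For l <> k, the factor at index k is the mean of a, which vanishes. *)
  rewrite sum_tuple_prod (bigD1 k) //= {1}/F eqxx [k == l]eq_sym.
  have [e|lk] := eqVneq l k; last first.
    by under eq_bigr do rewrite mulr1; rewrite a0 mul0r.
  rewrite [X in _ * X]big1 ?mulr1; first by under eq_bigr do rewrite -expr2.
  move=> r rk; rewrite /F e (negbTE rk) -[RHS]p1.
  by apply: eq_bigr => i _; rewrite !mulr1.
under eq_bigr => s _.
  rewrite expr2 mulr_suml mulr_sumr.
  under eq_bigr do rewrite mulr_sumr mulr_sumr.
  over.
rewrite exchange_big /=.
under eq_bigr => k _.
  rewrite exchange_big /=.
  under eq_bigr do rewrite mom.
  rewrite -big_mkcond big_pred1_eq.
  over.
by rewrite sumr_const card_ord mulr_natl.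
Qed.

Lemma enorm_sqr (R : realType) (d : nat) (v : 'cV[R]_d) :
  enorm v ^+ 2 = \sum_(j < d) v j 0 ^+ 2.
Proof. by rewrite sqr_sqrtr// sumr_ge0// => j _; exact: sqr_ge0. Qed.

Lemma enorm_ge0 (R : realType) (d : nat) (v : 'cV[R]_d) : 0 <= enorm v.
Proof. exact: sqrtr_ge0. Qed.

(** Summing over indices with multiplicity is summing over the draws. *)
Lemma sum_count_mem (R : pzRingType) (I : finType) (m : nat) (s : m.-tuple I)
    (c : I -> R) :
  \sum_i c i * (count_mem i s)%:R = \sum_(k < m) c (tnth s k).
Proof.
rewrite -(big_tuple _ _ s xpredT c).
under [LHS]eq_bigr => i _.
  rewrite -sum1_count natr_sum mulr_sumr big_mkcond /=. over.
rewrite exchange_big /=; apply: eq_bigr => k _.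
by rewrite -big_mkcond (big_pred1 k) ?mulr1// => i; rewrite /= eq_sym.
Qed.

(** In each coordinate, the sampling error is the normalized sum over the draws
    [i] of [g i / p i - \sum_j g j], which is a centered variable when [i] has
    law [p]. *)
Lemma sampling_errorE (R : realType) (d n tau : nat)
    (f : 'I_n -> 'cV[R]_d -> R) (p : 'I_n -> R) (s : tau.-tuple 'I_n)
    (x y : 'cV[R]_d) (j : 'I_d) : (0 < tau)%N ->
  let g i := (grad (f i) x - grad (f i) y) j 0 in
  sampling_error f p s x y j 0 =
  (n%:R * tau%:R)^-1 *
    \sum_(k < tau) (g (tnth s k) / p (tnth s k) - \sum_i g i).
Proof.
move=> tau_gt0 g.
have tau0 : tau%:R != 0 :> R by rewrite pnatr_eq0 -lt0n.
have DE i : (grad_mx f x - grad_mx f y) j i = g i by rewrite /g !mxE.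
rewrite /sampling_error /theta_mx /I_mx /all_ones.
rewrite !mxE.
under eq_bigr => i _.
  rewrite [const_mx _ _ _]mxE mulr1 mul_mx_diag mxE mul_mx_diag.
  rewrite mxE DE !mxE.
  over.
under [X in _ - _ * X]eq_bigr => i _ do rewrite [const_mx _ _ _]mxE DE mulr1.
rewrite sum_count_mem sumrB sumr_const card_ord -mulrBr invfM -mulrA.
congr (_ * _).
rewrite mulrBr -[(\sum_i g i) *+ tau]mulr_natl mulKf// mulr_sumr; congr (_ - _).
by apply: eq_bigr => k _; rewrite invfM mulrCA.
Qed.

(** A variance is at most the uncentered second moment, for the variable
    [g i / p i], whose mean under [p] is [\sum_i g i]. *)
Lemma second_moment_centered_le (R : realFieldType) (I : finType)
    (p g : I -> R) :
  (forall i, 0 < p i) -> \sum_i p i = 1 ->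
  \sum_i p i * (g i / p i - \sum_j g j) ^+ 2 <= \sum_i g i ^+ 2 / p i.
Proof.
move=> p_gt0 p1; set G := \sum_j g j.
have -> : \sum_i p i * (g i / p i - G) ^+ 2 = \sum_i g i ^+ 2 / p i - G ^+ 2.
  transitivity (\sum_i (g i ^+ 2 / p i - g i * (G *+ 2) + p i * G ^+ 2)).
    apply: eq_bigr => i _; have := lt0r_neq0 (p_gt0 i) => pi0.
    by field.
  by rewrite big_split sumrB -!mulr_suml p1 -/G /=; ring.
by rewrite gerBl sqr_ge0.
Qed.

(** The bound [\bar L ^ 2 / tau] is an admissible constant. *)
Lemma expected_sampling_error_le (R : realType) (dT : measure_display)
    (T : measurableType dT) (P : probability T R) (d n tau : nat)
    (f : 'I_n -> 'cV[R]_d -> R) (L : 'I_n -> R) (p : 'I_n -> R)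
    (S : T -> tau.-tuple 'I_n) (x y : 'cV[R]_d) :
  (0 < n)%N -> (0 < tau)%N -> (forall i, 0 < L i) ->
  (forall i, smooth (L i) (f i)) ->
  (forall i, p i = L i / \sum_(j < n) L j) ->
  sampling_with_replacement P p S ->
  ('E_P[(fun w => enorm (sampling_error f p (S w) x y) ^+ 2)%R] <=
   ((n%:R^-1 * \sum_(i < n) L i) ^+ 2 / tau%:R * enorm (x - y) ^+ 2)%:E)%E.
Proof.
move=> n_gt0 tau_gt0 L_gt0 f_smooth pE HS.
have sumL_gt0 : 0 < \sum_(j < n) L j.
  rewrite (bigD1 (Ordinal n_gt0))//= ltr_pwDl// sumr_ge0// => i _.
  exact: ltW.
have p_gt0 i : 0 < p i by rewrite pE divr_gt0.
have p1 : \sum_i p i = 1.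
  by under eq_bigr do rewrite pE; rewrite -mulr_suml divff ?lt0r_neq0.
have tau0 : tau%:R != 0 :> R by rewrite pnatr_eq0 -lt0n.
have n0 : n%:R != 0 :> R by rewrite pnatr_eq0 -lt0n.
rewrite (expectation_finite_range (measurable_sample HS) (sample_law HS)
  (F := fun s => enorm (sampling_error f p s x y) ^+ 2)); last first.
  by move=> s; exact: sqr_ge0.
rewrite lee_fin.
pose g i := grad (f i) x - grad (f i) y.
set c : R := (n%:R * tau%:R)^-1.
pose h j i := g i j 0 / p i - \sum_l g l j 0.
have h0 j : \sum_i p i * h j i = 0.
  under eq_bigr do rewrite mulrBr mulrC divfK ?lt0r_neq0//.
  by rewrite sumrB -mulr_suml p1 mul1r subrr.
have -> : \sum_s (\prod_(k < tau) p (tnth s k)) *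
      enorm (sampling_error f p s x y) ^+ 2 =
    \sum_(j < d) c ^+ 2 * (tau%:R * \sum_i p i * h j i ^+ 2).
  under eq_bigr do rewrite enorm_sqr mulr_sumr.
  rewrite exchange_big; apply: eq_bigr => j _ /=.
  rewrite -(sum_sqr_centered_iid tau p1 (h0 j)) mulr_sumr.
  by apply: eq_bigr => s _; rewrite sampling_errorE// exprMn mulrCA.
apply: (@le_trans _ _ (c ^+ 2 * (tau%:R * \sum_i enorm (g i) ^+ 2 / p i))).
  rewrite -!mulr_sumr !ler_wpM2l ?sqr_ge0//.
  under [leRHS]eq_bigr do rewrite enorm_sqr mulr_suml.
  rewrite [leRHS]exchange_big; apply: ler_sum => j _ /=.
  exact: second_moment_centered_le.
apply: (@le_trans _ _ (c ^+ 2 *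
    (tau%:R * ((\sum_i L i) ^+ 2 * enorm (x - y) ^+ 2)))).
  rewrite !ler_wpM2l ?sqr_ge0//.
  rewrite [X in X * _]expr2 -mulrA mulr_suml; apply: ler_sum => i _.
  (* This choice of p makes the i-th term proportional to L i. *)
  rewrite pE invf_div.
  have -> : L i * ((\sum_j L j) * enorm (x - y) ^+ 2) =
      (L i * enorm (x - y)) ^+ 2 * ((\sum_j L j) / L i).
    by field; rewrite lt0r_neq0.
  have Li_ge0 := ltW (L_gt0 i); have sumL_ge0 := ltW sumL_gt0.
  rewrite ler_wpM2r ?divr_ge0// ler_sqr ?nnegrE ?mulr_ge0 ?enorm_ge0//.
  by case: (f_smooth i) => _; apply.
rewrite le_eqVlt; apply/orP; left; apply/eqP; rewrite /c.
by field; rewrite n0 tau0.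
Qed.

(** The least constant exists as soon as some constant is admissible: each
    defining inequality is closed in the constant, so the infimum is itself
    admissible. *)
Lemma is_calL3_exists (R : realType) (dT : measure_display)
    (T : measurableType dT) (P : probability T R) (d n tau : nat)
    (f : 'I_n -> 'cV[R]_d -> R) (p : 'I_n -> R) (S : T -> tau.-tuple 'I_n)
    (c : R) :
  calL3_bound P f p S c ->
  exists calL3 : R, is_calL3 P f p S calL3 /\ calL3 <= c.
Proof.
set B := calL3_bound P f p S => Bc.
have B0 : lbound B 0 by move=> b [].
have infB : lbound B (inf B) by move=> b; apply: ge_inf; exists 0.
exists (inf B); split; last exact: infB.
split; last exact: infB.
split=> [|x y]; first by apply: lb_le_inf => //; exists c.
set E := expectation.body _ _.
have E_ge0 : (0 <= E)%E.
  by rewrite /E unlock; apply: integral_ge0 => w _; rewrite lee_fin sqr_ge0.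
have EB b : B b -> (E <= (b * enorm (x - y) ^+ 2)%:E)%E.
  by move=> [_]; apply.
have [e eE] : exists e, E = e%:E.
  have := EB _ Bc; case: (E) E_ge0 => [e _ _|//|//]; by exists e.
(* Dividing by the squared distance requires x <> y; otherwise the right-hand
   side vanishes for every constant. *)
rewrite eE lee_fin.
have [D0|D0] := eqVneq (enorm (x - y) ^+ 2) 0.
  by have := EB _ Bc; rewrite eE lee_fin D0 !mulr0.
have D_gt0 : 0 < enorm (x - y) ^+ 2 by rewrite lt0r D0 sqr_ge0.
rewrite -ler_pdivrMr//; apply: lb_le_inf; first by exists c.
by move=> b /EB; rewrite eE lee_fin ler_pdivrMr.
Qed.

Unset Implicit Arguments.
Set Strict Implicit.
Set Printing Implicit Defensive.

Theorem propositionH6 (R : realType) (dT : measure_display)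
    (T : measurableType dT) (P : probability T R) (d n tau : nat)
    (f : 'I_n -> 'cV[R]_d -> R) (L : 'I_n -> R) (p : 'I_n -> R)
    (S : T -> tau.-tuple 'I_n)
    (tau_ge1 : (1 <= tau)%N)
    (L_gt0 : forall i, 0 < L i)
    (f_smooth : forall i, smooth (L i) (f i))
    (pE : forall i, p i = L i / \sum_(j < n) L j)
    (S_sampling : sampling_with_replacement P p S) :
  exists calL3 : R,
    is_calL3 P f p S calL3 /\ calL3 <= (n%:R^-1 * \sum_(i < n) L i) ^+ 2 / tau%:R.
Proof.
(* A draw is an element of 'I_n, so that n cannot be zero. *)
have n_gt0 : (0 < n)%N.
  have i := tnth (S point) (Ordinal tau_ge1).
  exact: leq_ltn_trans (ltn_ord i).
apply: is_calL3_exists; split=> [|x y]; last exact: expected_sampling_error_le.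
by rewrite divr_ge0// sqr_ge0.
Qed.
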